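(* Let $p$ be an odd prime, let $a$ be a positive integer, and let $d\in\{0,1,\ldots,p^a\}$. Then $$\sum_{k=0}^{p^a-1}(-1)^k\binom{2k}{k+d}\equiv(-1)^{d-[p\neq5]}F_{2\left(d-\left(\frac{p^a}{5}\right)\right)}\pmod p,$$ and, provided $d>0$, $$d\sum_{k=1}^{p^a-1}(-1)^k\frac{\binom{2k}{k+d}}{k}\equiv(-1)^{d-[p=5]}L_{2\left(d-\left(\frac{p^a}{5}\right)\right)}-2(-1)^d\pmod p.$$ Also, $$\sum_{k=0}^{p^a-1}\frac{\binom{2k}{k+d}}{2^k}\equiv\begin{cases}0\pmod p&\text{if } p^a\equiv d\pmod 2,\\ 1\pmod p&\text{if } p^a\equiv d+1\pmod 4,\\ -1\pmod p&\text{if } p^a\equiv d-1\pmod 4,\end{cases}$$ and for $d>0$, $$d\sum_{k=1}^{p^a-1}\frac{\binom{2k}{k+d}}{k\,2^{k}}-(-1)^d\equiv\begin{cases}0\pmod p&\text{if } p^a\not\equiv d\pmod 2,\\ 1\pmod p&\text{if } p^a\equiv d\pmod 4,\\ -1\pmod p&\text{if } p^a\equiv d+2\pmod 4.\end{cases}$$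
   Context: For an assertion $A$, $[A]=1$ if $A$ holds and $[A]=0$ otherwise. $\left(\frac{\cdot}{5}\right)$ is the Jacobi (Legendre) symbol modulo $5$, with value $0$ on multiples of $5$. The Fibonacci numbers are $F_0=0$, $F_1=1$, $F_{n+1}=F_n+F_{n-1}$ for $n\ge1$, extended by $F_{-1}=1$, $F_{-2}=-1$. The Lucas numbers are $L_0=2$, $L_1=1$, $L_{n+1}=L_n+L_{n-1}$ for $n\ge1$, extended by $L_{-1}=-1$, $L_{-2}=3$. $\binom{n}{k}=0$ if $k>n\ge 0$ or $k<0$. Congruences modulo $p$ between rational numbers are understood in the ring of rational numbers whose denominator is prime to $p$. *)

(* Defs.v *)
From mathcomp Require Import all_boot all_order all_algebra.

Set Implicit Arguments.
Unset Strict Implicit.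
Unset Printing Implicit Defensive.

Import Order.TTheory GRing.Theory Num.Theory.

Local Open Scope ring_scope.

Definition legendre (n p : nat) : int :=
  if (p %| n)%N then 0
  else if [exists x : 'I_p, x ^ 2 == n %[mod p]]%N then 1 else -1.

Fixpoint fib_nat (n : nat) : int :=
  match n with
  | 0 => 0
  | 1 => 1
  | (m.+1 as k).+1 => fib_nat k + fib_nat m
  end.

Fixpoint lucas_nat (n : nat) : int :=
  match n with
  | 0 => 2
  | 1 => 1
  | (m.+1 as k).+1 => lucas_nat k + lucas_nat m
  end.

(* [fib_opp n] is F_{-n} and [lucas_opp n] is L_{-n}: the recurrence run
   backwards, F_{-n-2} = F_{-n} - F_{-n-1}. *)
Fixpoint fib_opp (n : nat) : int :=
  match n with
  | 0 => 0
  | 1 => 1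
  | (m.+1 as k).+1 => fib_opp m - fib_opp k
  end.

Fixpoint lucas_opp (n : nat) : int :=
  match n with
  | 0 => 2
  | 1 => -1
  | (m.+1 as k).+1 => lucas_opp m - lucas_opp k
  end.

(* [Negz n] is the integer - n.+1. *)
Definition fib (m : int) : int :=
  match m with Posz n => fib_nat n | Negz n => fib_opp n.+1 end.

Definition lucas (m : int) : int :=
  match m with Posz n => lucas_nat n | Negz n => lucas_opp n.+1 end.

Lemma fib_neg12 : fib (-1) = 1 /\ fib (-2) = -1.
Proof. by []. Qed.

Lemma lucas_neg12 : lucas (-1) = -1 /\ lucas (-2) = 3.
Proof. by []. Qed.

Definition p_integral (p : nat) (x : rat) : Prop :=
  coprime p `|denq x|.

(* Both sides must lie in the ring of p-integral rationals, and they must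
   differ by an element of the ideal of that ring generated by p. *)
Definition eq_mod_p (p : nat) (x y : rat) : Prop :=
  [/\ p_integral p x, p_integral p y
    & exists2 z : rat, p_integral p z & x - y = p%:R * z].

(* Main.v *)
Require Import Defs.
From mathcomp Require Import all_boot all_order all_algebra all_field.
From mathcomp Require Import ring zify.

Set Implicit Arguments.
Unset Strict Implicit.
Unset Printing Implicit Defensive.

Import Order.TTheory GRing.Theory Num.Theory.

Local Open Scope ring_scope.

(* Write n = p^a. Modulo p, Frobenius turns the polynomial
   P = sum_(k < n) (x X)^(n-1-k) (1 + X)^(2k) into
   (1 - (x - 2) X^n + X^(2n)) / (1 - (x - 2) X + X^2), so below degree n its
   coefficients are the U_(m+1)(x - 2), where U_0 = 0, U_1 = 1 and
   U_(m+2)(y) = y U_(m+1)(y) - U_m(y); the coefficient of degree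
   n - 1 - d is the first kind of sum, multiplied by x^(n-1) = 1. Since
   d/k 'C(2k, k + d) = 'C(2j, j + d - 1) - 'C(2j, j + d + 1) for j = k - 1, the
   second kind is a difference of two sums of the first kind, up to the boundary
   term j = n - 1, which is what the case x = 0 computes.

   For x = 2 the sequence U(0) has period 4. For x = -1 the Binet formulas
   express U(-3) through Fibonacci numbers, and for p != 5 the index n can be
   replaced by the Legendre symbol (n/5) because the golden ratio is, up to
   sign, a sum of two fifth roots of unity; modulo 5 one has -3 = 2 and U_m(2) = m. *)

(** * The sequences U and V, and the quotients that generate U *)

Fixpoint lucasU (R : comNzRingType) (y : R) (n : nat) : R :=
  match n with
  | 0 => 0
  | 1 => 1
  | (m.+1 as k).+1 => y * lucasU y k - lucasU y m
  end.

(* For m > 0 this is U_{m+1} - U_{m-1}. *)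
Definition lucasV (R : comNzRingType) (y : R) (m : nat) : R :=
  2 * lucasU y m.+1 - y * lucasU y m.

Lemma lucasUSS (R : comNzRingType) (y : R) m :
  lucasU y m.+2 = y * lucasU y m.+1 - lucasU y m.
Proof. by []. Qed.

Lemma lucasVE (R : comNzRingType) (y : R) m :
  lucasU y m.+2 - lucasU y m = lucasV y m.+1.
Proof. rewrite /lucasV lucasUSS; ring. Qed.

Lemma lucasVSS (R : comNzRingType) (y : R) m :
  lucasV y m.+2 = y * lucasV y m.+1 - lucasV y m.
Proof. rewrite /lucasV !lucasUSS; ring. Qed.

(** The term ['X^n * Q] is invisible below degree n, so comparing coefficients gives P_m = [m = 0] +
    y P_(m-1) - P_(m-2), the recurrence of U shifted by one. *)
Lemma coef_quotient_lucasU (R : comNzRingType) (y : R) (P Q : {poly R}) n :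
  P * (1 - y *: 'X + 'X^2) = 1 + 'X^n * Q ->
  forall m, (m < n)%N -> P`_m = lucasU y m.+1.
Proof.
move=> defP.
have coefP m : (m < n)%N ->
    P`_m = (m == 0)%:R + y * ('X * P)`_m - ('X^2 * P)`_m.
  move=> lt_mn; have: ('X^n * Q)`_m = 0 by rewrite coefXnM lt_mn.
  have -> : 'X^n * Q = P - y *: ('X * P) + 'X^2 * P - 1.
    have -> : 'X^n * Q = P * (1 - y *: 'X + 'X^2) - 1 by rewrite defP; ring.
    rewrite -!mul_polyC; ring.
  by rewrite !(coefD, coefN) coefZ coef1 => /eqP; rewrite subr_eq0 => /eqP <-;
    ring.
elim/ltn_ind => -[|[|m]] IHm lt_mn; rewrite coefP // coefXM coefXnM.
- by rewrite /=; ring.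
- by rewrite (IHm 0 isT (ltnW lt_mn)) /=; ring.
rewrite subn2 [_.-2]/= ![_.+1.-1]/= !IHm; try lia.
by rewrite (lucasUSS _ m.+1) /=; ring.
Qed.

(** * Sums of central binomial coefficients in characteristic p *)

Lemma coef_exp1DX (R : comNzRingType) k i :
  ((1 + 'X : {poly R}) ^+ k)`_i = 'C(k, i)%:R.
Proof.
rewrite addrC -[1]/(1%:P) exprDn coef_sum.
under eq_bigr => j _ do rewrite -polyC_exp expr1n mulr1 coefMn coefXn.
case: (ltnP i k.+1) => [lt_ik|le_ki]; last first.
  rewrite bin_small // big1 // => j _.
  by rewrite (_ : i == _ = false) ?mul0rn //; apply/eqP; have := ltn_ord j; lia.
have lt' : (k - i < k.+1)%N by lia.
rewrite (bigD1 (Ordinal lt')) //= big1 ?addr0 => [|j /eqP neq_j].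
  rewrite subKn // eqxx -bin_sub ?subKn //; lia.
by rewrite (_ : i == _ = false) ?mul0rn //; apply/eqP => e; case: neq_j;
  apply/val_inj => /=; have := ltn_ord j; lia.
Qed.

(** The product of P with xX - (1 + X)^2 telescopes to (xX)^n - (1 + X)^(2n), which Frobenius and
    x^n = x turn into x X^n - (1 + X^n)^2. In degree n - 1 - d the k-th summand of P contributes
    'C(2k, k - d) = 'C(2k, k + d), up to its power of x. *)
Lemma central_binomial_sum (R : comNzRingType) (p a d : nat) (x : R) :
  p \in [pchar R] -> x ^+ (p ^ a) = x -> (d <= p ^ a)%N ->
  \sum_(0 <= k < p ^ a) 'C(2 * k, k + d)%:R * x ^+ (p ^ a - 1 - k) =
  lucasU (x - 2) (p ^ a - d).
Proof.
move=> charRp; set n := (p ^ a)%N => x_n le_dn.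
have p_pr := pcharf_prime charRp.
have n_gt0 : (0 < n)%N by rewrite expn_gt0 prime_gt0.
have [->|neq_dn] := eqVneq d n.
  rewrite subnn /= big_nat big1 // => k /andP[_ lt_kn].
  by rewrite bin_small ?mul0r //; lia.
have {neq_dn} lt_dn : (d < n)%N by rewrite ltn_neqAle neq_dn.
pose P : {poly R} :=
  \sum_(i < n) (x *: 'X) ^+ (n.-1 - i) * ((1 + 'X) ^+ 2) ^+ i.
have defP : P * (1 - (x - 2) *: 'X + 'X^2)
            = 1 + 'X^n * ('X^n - (x - 2)%:P).
  have := subrXX (x *: 'X) ((1 + 'X) ^+ 2 : {poly R}) n; rewrite -/P.
  have -> : ((1 + 'X) ^+ 2 : {poly R}) ^+ n = (1 + 'X^n) ^+ 2.
    rewrite exprAC; congr (_ ^+ 2).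
    have n_char : [pchar {poly R}].-nat n.
      by rewrite pnatX pnatE // pchar_poly charRp.
    by rewrite (exprDn_pchar _ _ n_char) expr1n.
  rewrite exprZn x_n -!mul_polyC => e.
  have -> : 1 + 'X^n * ('X^n - (x - 2)%:P)
    = - (x%:P * 'X^n - (1 + 'X^n) ^+ 2) by rewrite polyCB; ring.
  by rewrite e polyCB; ring.
have lt_m : (n - d.+1 < n)%N by lia.
rewrite -(subnSK lt_dn) -(coef_quotient_lucasU defP lt_m) coef_sum big_mkord.
apply: eq_bigr => k _; have lt_kn := ltn_ord k.
rewrite exprZn -exprM -scalerAl coefZ coefXnM coef_exp1DX mulrC subn1.
congr (_ * _); case: ltnP => h.
  by rewrite bin_small //; lia.
rewrite -bin_sub; last lia.
by congr (('C(_, _))%:R); lia.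
Qed.

(** Pascal's rule applied twice turns the left side into d (A + 2B + C) with A, B, C consecutive in
    row 2k; the ratios of neighbours, [eB] and [eC], then give the identity. *)
Lemma binomial_difference (d k : nat) : (0 < d)%N ->
  d%:Z * 'C(2 * k.+1, k.+1 + d)%:Z =
  k.+1%:Z * ('C(2 * k, k + d.-1)%:Z - 'C(2 * k, k + d.+1)%:Z).
Proof.
case: d => // d _ /=; rewrite mulnS !addnS !addSn add0n !binS.
set A := 'C(_, k + d); set B := 'C(_, (k + d).+1); set C := 'C(_, (k + d).+2).
(* Over the integers k - d may be negative; both binomials then vanish, so truncated subtraction
   does no harm. *)
have eB : (k + d).+1%:Z * B%:Z = (k%:Z - d%:Z) * A%:Z.
  have [le_dk|lt_kd] := leqP d k; last first.
    by rewrite /A /B !bin_small ?mulr0 //; lia.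
  have := mul_bin_left (2 * k) (k + d); rewrite -/A -/B.
  by rewrite (_ : 2 * k - _ = k - d)%N; [nia|lia].
have eC : (k + d).+2%:Z * C%:Z = (k%:Z - d%:Z - 1) * B%:Z.
  have [le_dk|lt_kd] := ltnP d k; last first.
    by rewrite /B /C !bin_small ?mulr0 //; lia.
  have := mul_bin_left (2 * k) (k + d).+1; rewrite -/B -/C.
  by rewrite (_ : 2 * k - _ = k - d - 1)%N; [nia|lia].
nia.
Qed.

(** Taking [central_binomial_sum] at d - 1 and d + 1 evaluates the sum over all k < n. At x = 0 only
    k = n - 1 survives, as 0^0 = 1, so V(-2) is exactly the boundary term to remove. *)
Lemma central_binomial_difference_sum (R : comNzRingType) (p a d : nat)
    (x : R) :
  p \in [pchar R] -> x ^+ (p ^ a) = x -> (0 < d <= p ^ a)%N -> (0 < a)%N ->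
  x * \sum_(0 <= k < p ^ a - 1)
    ('C(2 * k, k + d.-1)%:R - 'C(2 * k, k + d.+1)%:R) * x ^+ (p ^ a - 2 - k)
  = lucasV (x - 2) (p ^ a - d) - lucasV (- 2) (p ^ a - d).
Proof.
move=> charRp; set n := (p ^ a)%N => x_n /andP[d_gt0 le_dn] a_gt0.
have p_pr := pcharf_prime charRp.
have n_gt1 : (1 < n)%N by rewrite -(exp1n a) ltn_exp2r ?prime_gt1.
(* For d = n the index d + 1 is out of range of [central_binomial_sum]; here every binomial vanishes
   and both values V_0 are 2. *)
have [->|neq_dn] := eqVneq d n.
  rewrite subnn big_nat big1 => [|k lt_kn]; first by rewrite /lucasV /=; ring.
  by rewrite !bin_small ?subrr ?mul0r //; lia.
have {neq_dn} lt_dn : (d < n)%N by rewrite ltn_neqAle neq_dn.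
have diff_sum (z : R) : z ^+ n = z -> \sum_(0 <= k < n)
    ('C(2 * k, k + d.-1)%:R - 'C(2 * k, k + d.+1)%:R) * z ^+ (n - 1 - k)
    = lucasV (z - 2) (n - d).
  move=> z_n; under eq_bigr => k _ do rewrite mulrBl.
  rewrite sumrB !(central_binomial_sum charRp z_n) -/n; try lia.
  rewrite (_ : n - d.-1 = (n - d.+1).+2)%N; last lia.
  by rewrite lucasVE; congr lucasV; lia.
have n0 : (0 : R) ^+ n = 0 by rewrite expr0n; case: (n) n_gt1.
have := diff_sum 0 n0; have := diff_sum x x_n.
have -> : n = n.-1.+1 by lia.
rewrite !big_nat_recr //= !subn1 /= subnn !expr0 !mulr1 sub0r => <-.
rewrite [X in X + _ = _ -> _]big_nat big1 => [|k lt_kn]; last first.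
  by rewrite expr0n subn_eq0 leqNgt (_ : k < _)%N ?mulr0.
rewrite add0r => <-; rewrite addrK big_distrr /= !big_nat.
apply: eq_bigr => k lt_kn; rewrite mulrCA -exprS.
by congr (_ * _ ^+ _); lia.
Qed.

(** * From equality in characteristic p to congruence of rationals *)

(** Numerator and denominator are coprime, so integrality of c x forces the denominator to divide c,
    which is prime to p. *)
Lemma p_integral_clear (p : nat) (x : rat) (c M : int) :
  prime p -> ~~ (p %| c)%Z -> c%:~R * x = M%:~R -> p_integral p x.
Proof.
move=> p_pr p'c cx; rewrite /p_integral prime_coprime //.
apply: contra p'c => p_den; have dvd_den : (denq x %| c)%Z.
  rewrite -(@Gauss_dvdzl (denq x) c (numq x)); last first.
    by rewrite coprimezE coprime_sym coprime_num_den.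
  apply/dvdzP; exists M; apply/(@intr_inj rat).
  by rewrite !rmorphM /= -cx numqE mulrA.
by apply: dvdz_trans dvd_den; rewrite dvdzE.
Qed.

(** In any ring of characteristic p an integer vanishes exactly when p divides it. Congruences can
    thus be checked in an extension field that contains fifth roots of unity. *)
Lemma eq_mod_p_clear (R : nzRingType) (p : nat) (c M N : int) (x y : rat) :
  p \in [pchar R] -> c%:~R != 0 :> R -> c%:~R * x = M%:~R ->
  c%:~R * y = N%:~R -> M%:~R = N%:~R :> R -> eq_mod_p p x y.
Proof.
move=> charRp c_neq0 cx cy eqMN; have p_pr := pcharf_prime charRp.
have p'c : ~~ (p %| c)%Z by rewrite (dvdz_pcharf charRp).
have p_neq0 : p%:R != 0 :> rat by rewrite pnatr_eq0 -lt0n prime_gt0.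
split; [exact: p_integral_clear cx | exact: p_integral_clear cy |].
have /dvdzP[q def_q] : (p %| M - N)%Z.
  by rewrite (dvdz_pcharf charRp) rmorphB /= eqMN subrr.
exists ((x - y) / p%:R); last by rewrite mulrC divfK.
apply: (p_integral_clear (M := q) p_pr p'c).
by rewrite mulrA mulrBr cx cy -rmorphB /= def_q rmorphM /= mulfK.
Qed.

Lemma central_binomial_sum_mod (K : fieldType) (p a d : nat) (x N : int) :
  p \in [pchar K] -> x%:~R != 0 :> K -> (x%:~R : K) ^+ (p ^ a) = x%:~R ->
  (d <= p ^ a)%N -> lucasU (x%:~R - 2 : K) (p ^ a - d) = N%:~R ->
  eq_mod_p p (\sum_(0 <= k < p ^ a) 'C(2 * k, k + d)%:R / x%:~R ^+ k) N%:~R.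
Proof.
move=> charKp x_neq0 x_n le_dn eqN; set n := (p ^ a)%N in x_n le_dn eqN *.
have n_gt0 : (0 < n)%N by rewrite expn_gt0 prime_gt0 ?(pcharf_prime charKp).
have x_pred : (x%:~R : K) ^+ n.-1 = 1.
  by apply: (mulfI x_neq0); rewrite -exprS prednK // mulr1.
have xQ_neq0 : x%:~R != 0 :> rat.
  by rewrite intr_eq0; apply: contra x_neq0 => /eqP ->.
(* The factor x^(n-1) clears every x^k with k < n and equals 1 in K, so it leaves residues
   unchanged. *)
apply: (@eq_mod_p_clear K p (x ^+ n.-1)
  (\sum_(0 <= k < n) 'C(2 * k, k + d)%:R * x ^+ (n - 1 - k))
  (x ^+ n.-1 * N)) => //.
- by rewrite rmorphXn /= x_pred oner_neq0.
- rewrite rmorph_sum big_distrr /= !big_nat; apply: eq_bigr => k lt_kn.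
  rewrite rmorphM !rmorphXn /= rmorph_nat mulrCA; congr (_ * _).
  by rewrite subn1 expfB_cond // (negPf xQ_neq0) /=; lia.
- by rewrite rmorphM.
rewrite rmorphM rmorphXn /= x_pred mul1r -eqN -(central_binomial_sum charKp) //.
rewrite rmorph_sum /=; apply: eq_bigr => k _.
by rewrite rmorphM rmorphXn /= rmorph_nat.
Qed.

(** The integer z is a correction: it will be 0 for x = -1 and (-1)^d for x = 2. *)
Lemma central_binomial_difference_sum_mod (K : fieldType) (p a d : nat)
    (x z N : int) :
  p \in [pchar K] -> x%:~R != 0 :> K -> (x%:~R : K) ^+ (p ^ a) = x%:~R ->
  (0 < d <= p ^ a)%N -> (0 < a)%N ->
  lucasV (x%:~R - 2 : K) (p ^ a - d) - lucasV (- 2 : K) (p ^ a - d)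
    = x%:~R * (N + z)%:~R ->
  eq_mod_p p (d%:R * (\sum_(1 <= k < p ^ a)
    'C(2 * k, k + d)%:R / (k%:R * x%:~R ^+ k)) - z%:~R) N%:~R.
Proof.
move=> charKp x_neq0 x_n d_bounds a_gt0 eqN.
have sumE := central_binomial_difference_sum charKp x_n d_bounds a_gt0.
set n := (p ^ a)%N in x_n d_bounds eqN sumE *.
have n_gt1 : (1 < n)%N.
  by rewrite -(exp1n a) ltn_exp2r ?prime_gt1 ?(pcharf_prime charKp).
clearbody n.
have x_pred : (x%:~R : K) ^+ n.-1 = 1.
  by apply: (mulfI x_neq0); rewrite -exprS prednK ?mulr1 // ltnW.
have xQ_neq0 : x%:~R != 0 :> rat.
  by rewrite intr_eq0; apply: contra x_neq0 => /eqP ->.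
(* A denominator k may be divisible by p, so no multiplier prime to p clears it;
   [binomial_difference] at k - 1 absorbs it, and [M] is the resulting integer sum. *)
pose M : int := \sum_(0 <= k < n - 1)
    ('C(2 * k, k + d.-1)%:R - 'C(2 * k, k + d.+1)%:R) * x ^+ (n - 2 - k).
apply: (@eq_mod_p_clear K p (x ^+ n.-1) (M - x ^+ n.-1 * z) (x ^+ n.-1 * N)).
- by [].
- by rewrite rmorphXn /= x_pred oner_neq0.
- rewrite mulrBr rmorphB rmorphM /=; congr (_ - _).
  rewrite /M rmorph_sum /= big_add1 -subn1.
  rewrite mulrA big_distrr /= !big_nat; apply: eq_bigr => k lt_kn.
  have := binomial_difference k (proj1 (andP d_bounds)).
  move/(congr1 (fun u : int => u%:~R : rat)).
  rewrite !(rmorphM, rmorphB) /= -!pmulrn => binE.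
  have k_neq0 : k.+1%:R != 0 :> rat by rewrite pnatr_eq0.
  have -> : (n - 1 = (n - 2 - k) + k.+1)%N by lia.
  rewrite exprD !(rmorphM, rmorphB, rmorphXn) !rmorph_nat /=.
  transitivity ((x%:~R : rat) ^+ (n - 2 - k)
      * (d%:R * 'C(2 * k.+1, k.+1 + d)%:R) / k.+1%:R).
    by field; rewrite nat1r k_neq0 expf_neq0.
  by rewrite binE; field; rewrite nat1r.
- by rewrite rmorphM.
apply: (mulfI x_neq0); rewrite rmorphB !rmorphM !rmorphXn /= x_pred !mul1r.
have -> : N%:~R = (N + z)%:~R - z%:~R :> K by rewrite rmorphD addrK.
rewrite !mulrBr -eqN -sumE rmorph_sum /=; congr (_ * _ - _).
apply: eq_bigr => k _.
by rewrite rmorphM rmorphB rmorphXn /= !rmorph_nat.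
Qed.

(** * Binet formulas and values at special arguments *)

Lemma lucasU_Binet (R : comNzRingType) (r s : R) m :
  r * s = 1 -> (r - s) * lucasU (r + s) m = r ^+ m - s ^+ m.
Proof.
move=> rs1; elim/ltn_ind: m => -[|[|m]] IHm; [rewrite /=; ring.. |].
rewrite lucasUSS mulrBr mulrCA !IHm // !exprS.
transitivity (r * (r * r ^+ m) - s * (s * s ^+ m)
    + (r * s - 1) * (r ^+ m - s ^+ m)); first by ring.
by rewrite rs1 subrr mul0r addr0.
Qed.

Lemma lucasV_Binet (R : comNzRingType) (r s : R) m :
  r * s = 1 -> lucasV (r + s) m = r ^+ m + s ^+ m.
Proof.
move=> rs1; elim/ltn_ind: m => -[|[|m]] IHm; [rewrite /lucasV/=; ring.. |].
rewrite lucasVSS !IHm // !exprS.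
transitivity (r * (r * r ^+ m) + s * (s * s ^+ m)
    + (r * s - 1) * (r ^+ m + s ^+ m)); first by ring.
by rewrite rs1 subrr mul0r addr0.
Qed.

Lemma lucasU2 (R : comNzRingType) m : lucasU (2 : R) m = m%:R.
Proof.
elim/ltn_ind: m => -[|[|m]] IHm //.
by rewrite lucasUSS !IHm // -addn2 natrD -addn1 natrD; ring.
Qed.

Lemma lucasU0_double (R : comNzRingType) m : lucasU (0 : R) m.*2 = 0.
Proof. by elim: m => // m IHm; rewrite doubleS lucasUSS IHm; ring. Qed.

Lemma lucasU0_doubleS (R : comNzRingType) m :
  lucasU (0 : R) m.*2.+1 = (-1) ^+ m.
Proof. by elim: m => // m IHm; rewrite doubleS lucasUSS IHm exprS; ring. Qed.

Lemma golden_roots (K : fieldType) (r s : K) :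
  r + s = 1 -> r * s = -1 -> [/\ r * r = r + 1, s * s = s + 1,
    r^-1 = - s & s^-1 = - r].
Proof.
move=> r_s rs; have defs : s = 1 - r by rewrite -r_s; ring.
split.
- have -> : r * r = r - r * s by rewrite defs; ring.
  by rewrite rs opprK.
- have -> : s * s = s - r * s by rewrite defs; ring.
  by rewrite rs opprK.
- by apply: mulr1_eq; rewrite mulrN rs opprK.
- by apply: mulr1_eq; rewrite mulrN mulrC rs opprK.
Qed.

Lemma Binet_fib (K : fieldType) (r s : K) (m : int) :
  r + s = 1 -> r * s = -1 -> (r - s) * (fib m)%:~R = r ^ m - s ^ m.
Proof.
move=> r_s rs; have [r2 s2 rV sV] := golden_roots r_s rs.
case: m => m.
  change ((r - s) * (fib_nat m)%:~R = r ^+ m - s ^+ m).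
  elim/ltn_ind: m => -[|[|m]] IHm; [rewrite /=; ring.. |].
  rewrite [fib_nat _]/(fib_nat m.+1 + fib_nat m) rmorphD mulrDr !IHm //.
  by rewrite !exprS !mulrA r2 s2; ring.
(* Negative powers of r and s are natural powers of -s and -r, the roots of t^2 = 1 - t, which is
   the recurrence of [fib_opp]. *)
rewrite NegzE -!exprz_inv rV sV.
change ((r - s) * (fib_opp m.+1)%:~R = (- s) ^+ m.+1 - (- r) ^+ m.+1).
elim/ltn_ind: (m.+1) => -[|[|k]] IHk; [rewrite /=; ring.. |].
rewrite [fib_opp _]/(fib_opp k - fib_opp k.+1) rmorphB mulrBr !IHk //.
by rewrite !exprS !mulrA !mulrNN r2 s2; ring.
Qed.

Lemma Binet_lucas (K : fieldType) (r s : K) (m : int) :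
  r + s = 1 -> r * s = -1 -> (lucas m)%:~R = r ^ m + s ^ m.
Proof.
move=> r_s rs; have [r2 s2 rV sV] := golden_roots r_s rs.
case: m => m.
  change ((lucas_nat m)%:~R = r ^+ m + s ^+ m).
  elim/ltn_ind: m => -[|[|m]] IHm; [by rewrite /=; ring | by rewrite /= r_s |].
  have -> :
    (lucas_nat m.+2)%:~R = (lucas_nat m.+1)%:~R + (lucas_nat m)%:~R :> K.
    by rewrite -rmorphD.
  rewrite !IHm //.
  by rewrite !exprS !mulrA r2 s2; ring.
rewrite NegzE -!exprz_inv rV sV.
change ((lucas_opp m.+1)%:~R = (- s) ^+ m.+1 + (- r) ^+ m.+1 :> K).
elim/ltn_ind: (m.+1) => -[|[|k]] IHk; first by rewrite /=; ring.
  by rewrite /= !expr1 -opprD [s + r]addrC r_s.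
have -> : (lucas_opp k.+2)%:~R = (lucas_opp k)%:~R - (lucas_opp k.+1)%:~R :> K.
  by rewrite -rmorphB.
rewrite !IHk //.
by rewrite !exprS !mulrA !mulrNN r2 s2; ring.
Qed.

(** * The Legendre symbol modulo 5 and Frobenius on the golden ratio *)

Lemma legendre5E n :
  legendre n 5 = nth 0 [:: 0; 1; -1; -1; 1] (n %% 5).
Proof.
rewrite /legendre /dvdn; under eq_existsb => x do rewrite -(modn_mod n).
have: (n %% 5 < 5)%N by rewrite ltn_mod.
case: (n %% 5)%N => [|[|[|[|[|//]]]]] _ //=.
- by case: existsP => // -[]; exists (inord 1); rewrite inordK.
- by case: existsP => // -[] [[|[|[|[|[|//]]]]]].
- by case: existsP => // -[] [[|[|[|[|[|//]]]]]].
- by case: existsP => // -[]; exists (inord 2); rewrite inordK.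
Qed.

Lemma exists_cyclotomic5_root (p : nat) : prime p ->
  exists (K : fieldType) (z : K),
    p \in [pchar K] /\ z ^+ 4 + z ^+ 3 + z ^+ 2 + z + 1 = 0.
Proof.
move=> p_pr; pose q : {poly 'F_p} := \poly_(i < 5) 1.
have size_q : size q = 5 by rewrite size_poly_eq ?oner_neq0.
have q_neq0 : q != 0 by rewrite -size_poly_eq0 size_q.
have [L [rs q_rs _]] := FinSplittingFieldFor q_neq0.
have: (0 < size rs)%N.
  by have := eqp_size q_rs; rewrite size_prod_XsubC size_map_poly size_q => -[<-].
case: rs q_rs => // z rs q_rs _; exists L, z; split.
  by rewrite pchar_lalg pchar_Fp.
have: root (map_poly (in_alg L) q) z.
  by rewrite (eqp_root q_rs) root_prod_XsubC mem_head.
rewrite /root horner_coef size_map_poly size_q.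
under eq_bigr => i _ do rewrite coef_map coef_poly ltn_ord /= scale1r mul1r.
rewrite !big_ord_recl big_ord0 /= => /eqP <-; rewrite /bump /=; ring.
Qed.

(* With z a fifth root of unity, take r = - (z^2 + z^3) and s = - (z + z^4):
   the map z |-> z^n fixes r and s if n = 1 or 4 modulo 5 and swaps them
   otherwise. *)
Lemma golden_Frobenius (p : nat) : prime p -> odd p -> p != 5 ->
  exists (K : fieldType) (r s : K),
  [/\ p \in [pchar K], r + s = 1, r * s = -1, r != s & forall a,
     (r ^+ 2) ^+ (p ^ a) = (r ^+ 2) ^ legendre (p ^ a) 5 /\
     (s ^+ 2) ^+ (p ^ a) = (s ^+ 2) ^ legendre (p ^ a) 5].
Proof.
move=> p_pr p_odd p_neq5.
have [K [z [charKp z_root]]] := exists_cyclotomic5_root p_pr.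
have z5 : z ^+ 5 = 1.
  apply/eqP; rewrite -subr_eq0.
  have -> : z ^+ 5 - 1 = (z - 1) * (z ^+ 4 + z ^+ 3 + z ^+ 2 + z + 1) by ring.
  by rewrite z_root mulr0.
pose r := - (z ^+ 2 + z ^+ 3); pose s := - (z + z ^+ 4).
have r_s : r + s = 1.
  have -> : r + s = 1 - (z ^+ 4 + z ^+ 3 + z ^+ 2 + z + 1).
    by rewrite /r /s; ring.
  by rewrite z_root subr0.
have rs : r * s = -1.
  have -> : r * s = (z ^+ 4 + z ^+ 3 + z ^+ 2 + z + 1) - 1
      + (z ^+ 5 - 1) * (z + z ^+ 2) by rewrite /r /s; ring.
  by rewrite z_root z5 subrr mul0r addr0 add0r.
have [r2 s2 rV sV] := golden_roots r_s rs.
exists K, r, s; split=> //.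
  (* If r = s, the discriminant (r + s)^2 - 4 r s = 5 vanishes in K, forcing p = 5. *)
  apply: contra p_neq5 => /eqP eq_rs.
  have : 5%:R == 0 :> K.
    have -> : 5%:R = (r + s) ^+ 2 - 4%:R * (r * s) :> K by rewrite r_s rs; ring.
    by rewrite eq_rs; apply/eqP; ring.
  by rewrite -(dvdn_pcharf charKp) dvdn_prime2.
move=> a; set n := (p ^ a)%N.
have n_char : [pchar K].-nat n by rewrite pnatX pnatE ?charKp.
have r_n : r ^+ n = - (z ^+ (2 * n %% 5) + z ^+ (3 * n %% 5)).
  by rewrite (exprNn_pchar _ n_char) (exprDn_pchar _ _ n_char) -!exprM
    !(expr_mod _ z5).
have s_n : s ^+ n = - (z ^+ (n %% 5) + z ^+ (4 * n %% 5)).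
  by rewrite (exprNn_pchar _ n_char) (exprDn_pchar _ _ n_char) -!exprM
    !(expr_mod _ z5).
have n_mod5 : (n %% 5 != 0)%N.
  apply: contra p_neq5; rewrite -[_ == 0]/(5 %| n)%N Euclid_dvdX //.
  by case/andP; rewrite dvdn_prime2 // eq_sym.
rewrite legendre5E !(exprAC _ 2 n) r_n s_n.
rewrite -(modnMmr 2) -(modnMmr 3) -(modnMmr 4).
have := ltn_pmod n (isT : (0 < 5)%N).
(* Since r^-1 is s only up to sign, squares are used: swapping r^2 and s^2 is then inversion, which
   matches the symbol -1 for n = 2 or 3 modulo 5. *)
have [r2V s2V] : (r ^+ 2)^-1 = s ^+ 2 /\ (s ^+ 2)^-1 = r ^+ 2.
  by rewrite -!exprVn rV sV !sqrrN.
case: (n %% 5)%N n_mod5 => [|[|[|[|[|//]]]]] //= _ _.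
- rewrite -[(2 * 2 %% 5)%N]/4%N -[(3 * 2 %% 5)%N]/1%N -[(4 * 2 %% 5)%N]/3%N.
  by rewrite !exprN1 r2V s2V /r /s; split; ring.
- rewrite -[(2 * 3 %% 5)%N]/1%N -[(3 * 3 %% 5)%N]/4%N -[(4 * 3 %% 5)%N]/2%N.
  by rewrite !exprN1 r2V s2V /r /s; split; ring.
- rewrite -[(2 * 4 %% 5)%N]/3%N -[(3 * 4 %% 5)%N]/2%N -[(4 * 4 %% 5)%N]/1%N.
  by rewrite !expr1z /r /s; split; ring.
Qed.

(** Here e will be the Legendre symbol; u^(n-d) = u^(e-d), and passing to v = u^-1 gives the
    exponent d - e. *)
Lemma exprz_complement (K : fieldType) (u v : K) (n d : nat) (e : int) :
  u * v = 1 -> u ^+ n = u ^ e -> (d <= n)%N -> u ^+ (n - d) = v ^ (d%:Z - e).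
Proof.
move=> uv u_n le_dn; have vE : u^-1 = v by apply: mulr1_eq.
have u_neq0 : u != 0.
  by apply: contra_eq_neq uv => ->; rewrite mul0r eq_sym oner_neq0.
rewrite -vE exprz_inv opprB expfzDr // -u_n -exprnN.
by rewrite expfB_cond // (negPf u_neq0).
Qed.

(** Since r^2 + s^2 = 3, the Binet formulas for -3 have roots -r^2 and -s^2, whose product is 1.
    Oddness of n gives the sign -(-1)^d. *)
Lemma golden_lucasUV (K : fieldType) (r s : K) (n d : nat) (e : int) :
  r + s = 1 -> r * s = -1 -> r != s -> odd n -> (d <= n)%N ->
  (r ^+ 2) ^+ n = (r ^+ 2) ^ e -> (s ^+ 2) ^+ n = (s ^+ 2) ^ e ->
  lucasU (-1 - 2 : K) (n - d) = (-1) ^+ d * - (fib (2 * (d%:Z - e)))%:~R /\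
  lucasV (-1 - 2 : K) (n - d) = - ((-1) ^+ d * (lucas (2 * (d%:Z - e)))%:~R).
Proof.
move=> r_s rs neq_rs n_odd le_dn r_n s_n.
have [r2 s2 _ _] := golden_roots r_s rs.
have r2s2 : r ^+ 2 * s ^+ 2 = 1 by rewrite -exprMn rs sqrrN expr1n.
have s2r2 : s ^+ 2 * r ^+ 2 = 1 by rewrite mulrC.
have -> : -1 - 2 = - r ^+ 2 + - s ^+ 2 :> K.
  by rewrite !expr2 r2 s2 -r_s; ring.
have NrNs : - r ^+ 2 * - s ^+ 2 = 1 by rewrite mulrNN.
have sgn : (-1) ^+ (n - d) = - (-1) ^+ d :> K.
  rewrite -signr_odd oddB // n_odd -[in RHS](signr_odd _ d).
  by case: odd; rewrite /= ?opprK.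
have r_nd := exprz_complement r2s2 r_n le_dn.
have s_nd := exprz_complement s2r2 s_n le_dn.
have Z2 (t : K) m : (t ^+ 2) ^ m = t ^ (2 * m) by rewrite exprnP exprz_exp.
rewrite !Z2 in r_nd s_nd.
split; last first.
  rewrite (lucasV_Binet _ NrNs) !(exprNn (_ ^+ 2)) sgn r_nd s_nd.
  by rewrite (Binet_lucas _ r_s rs); ring.
have rs_neq0 : r - s != 0 by rewrite subr_eq0.
apply: (mulfI rs_neq0); rewrite mulrCA mulrN (Binet_fib _ r_s rs).
have := lucasU_Binet (n - d) NrNs.
rewrite !(exprNn (_ ^+ 2)) sgn r_nd s_nd.
(* As r + s = 1, r^2 - s^2 is r - s, the factor that occurs in the Fibonacci formula. *)
have -> : - r ^+ 2 - - s ^+ 2 = - (r - s).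
  by rewrite -[in RHS](mulr1 (r - s)) -r_s; ring.
rewrite mulNr => /(congr1 -%R); rewrite opprK => ->; ring.
Qed.

(** * The boundary value, signs, and the prime 5 *)

Lemma lucasV_N2 (R : comNzRingType) m : lucasV (- 2 : R) m = 2 * (-1) ^+ m.
Proof.
have -> : - 2 = -1 + -1 :> R by ring.
by rewrite lucasV_Binet ?mulrNN ?mulr1 //; ring.
Qed.

(** The exponent d - b can be -1, hence the integer power. *)
Lemma signz_sub_bool (R : unitRingType) (d : nat) (b : bool) :
  (-1) ^ (d%:Z - b%:Z) = (-1) ^+ d * (-1) ^+ b :> R.
Proof.
rewrite exprzDr ?unitrN1 //; case: b => /=; last by rewrite oppr0.
by rewrite exprN1 invrN1 expr1.
Qed.

(** Modulo 5, X^2 - X - 1 = (X - 3)^2 and 3^2 = -1, which explains the linear factor and the sign.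
    The odd index is carried along for the induction. *)
Lemma fib_double_mod5 (R : comNzRingType) (d : nat) : 5%:R = 0 :> R ->
  (fib_nat d.*2)%:~R = - ((-1) ^+ d * d%:R) :> R /\
  (fib_nat d.*2.+1)%:~R = (-1) ^+ d * (2 * d%:R + 1) :> R.
Proof.
move=> R5; elim: d => [|d [IH0 IH1]]; first by split; rewrite /=; ring.
have fibSS m : (fib_nat m.+2)%:~R = (fib_nat m.+1)%:~R + (fib_nat m)%:~R :> R.
  by rewrite -rmorphD.
rewrite doubleS !fibSS IH0 IH1 exprS -natr1; split; first by ring.
rewrite -[LHS]subr0 -(mul0r ((-1) ^+ d * (d%:R + 1) : R)) -R5; ring.
Qed.

Lemma lucas_double_mod5 (R : comNzRingType) (d : nat) : 5%:R = 0 :> R ->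
  (lucas_nat d.*2)%:~R = 2 * (-1) ^+ d :> R /\
  (lucas_nat d.*2.+1)%:~R = (-1) ^+ d :> R.
Proof.
move=> R5; elim: d => [|d [IH0 IH1]]; first by split; rewrite /=; ring.
have lucasSS m :
  (lucas_nat m.+2)%:~R = (lucas_nat m.+1)%:~R + (lucas_nat m)%:~R :> R.
  by rewrite -rmorphD.
rewrite doubleS !lucasSS IH0 IH1 exprS; split;
  rewrite -[LHS]subr0 -(mul0r ((-1) ^+ d : R)) -R5; ring.
Qed.

(** The field depends on p: for p != 5 it contains the golden ratio and its conjugate as distinct
    elements, while ['F_5] serves for p = 5, where they coincide. *)
Lemma golden_mod_p (p a d : nat) : prime p -> odd p -> (0 < a)%N ->
  (d <= p ^ a)%N -> exists K : fieldType, [/\ p \in [pchar K],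
    lucasU (-1 - 2 : K) (p ^ a - d) =
      ((-1) ^+ d * (-1) ^+ (p != 5)
        * fib (2 * (d%:Z - legendre (p ^ a) 5)))%:~R &
    lucasV (-1 - 2 : K) (p ^ a - d) =
      (- ((-1) ^+ d * (-1) ^+ (p == 5)
        * lucas (2 * (d%:Z - legendre (p ^ a) 5))))%:~R].
Proof.
move=> p_pr p_odd a_gt0 le_dn; have [p5|p_neq5] := eqVneq p 5; last first.
  have [K [r [s [charKp r_s rs neq_rs Frob]]]] :=
    golden_Frobenius p_pr p_odd p_neq5.
  have n_odd : odd (p ^ a) by rewrite oddX p_odd orbT.
  have [r_n s_n] := Frob a.
  exists K; have [-> ->] := golden_lucasUV r_s rs neq_rs n_odd le_dn r_n s_n.
  by split; rewrite // ?rmorphN !rmorphM !rmorphXn rmorphN1 /=; ring.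
rewrite {p_pr p_odd}p5 in le_dn *.
have charF : 5 \in [pchar 'F_5] by apply: pchar_Fp.
have F5 : 5%:R = 0 :> 'F_5 by apply: pcharf0 charF.
(* The symbol is 0 because 5 divides 5^a, so the index is the natural number 2d. *)
have d2 : 2 * (d%:Z - legendre (5 ^ a) 5) = Posz d.*2.
  by rewrite /legendre dvdn_exp // subr0 -mul2n.
have sgn2 : (-1) ^+ d * (-1) ^+ d = 1 :> 'F_5 by rewrite -expr2 sqrr_sign.
have [fib2d _] := fib_double_mod5 d F5.
have [lucas2d _] := lucas_double_mod5 d F5.
exists 'F_5; rewrite d2 [fib _]/(fib_nat _) [lucas _]/(lucas_nat _).
have -> : -1 - 2 = 2 :> 'F_5 by apply/val_inj.
split=> //.
  (* U_(n-d)(2) = n - d, which is -d modulo 5. *)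
  rewrite lucasU2 natrB // natrX F5 expr0n gtn_eqF //.
  rewrite !rmorphM !rmorphXn rmorphN1 /= fib2d sub0r.
  by rewrite expr0 mulr1 mulrN mulrA sgn2 mul1r.
rewrite /lucasV !lucasU2 rmorphN !rmorphM !rmorphXn rmorphN1 /= lucas2d.
rewrite expr1 mulrN1 mulNr opprK mulrCA sgn2 -natr1; ring.
Qed.

(** * Evaluation at x = -1 and x = 2 for the four congruences *)

Theorem corollary1p1 (p a d : nat) (p_prime : prime p) (p_odd : odd p)
    (a_gt0 : (0 < a)%N) (d_le : (d <= p ^ a)%N) :
  [/\ eq_mod_p p
        (\sum_(0 <= k < p ^ a) (-1) ^+ k * 'C(2 * k, k + d)%:R)
        ((-1) ^ (d%:Z - (p != 5)%N%:Z)
           * (fib (2 * (d%:Z - legendre (p ^ a) 5)))%:~R),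
      (0 < d)%N ->
      eq_mod_p p
        (d%:R * \sum_(1 <= k < p ^ a)
                   (-1) ^+ k * ('C(2 * k, k + d)%:R / k%:R))
        ((-1) ^ (d%:Z - (p == 5)%N%:Z)
           * (lucas (2 * (d%:Z - legendre (p ^ a) 5)))%:~R
         - 2 * (-1) ^+ d),
      let S := \sum_(0 <= k < p ^ a) 'C(2 * k, k + d)%:R / 2 ^+ k in
      [/\ ((p ^ a)%N = d %[mod 2])%Z -> eq_mod_p p S 0,
          ((p ^ a)%N = d%:Z + 1 %[mod 4])%Z -> eq_mod_p p S 1
        & ((p ^ a)%N = d%:Z - 1 %[mod 4])%Z -> eq_mod_p p S (-1)]
    & (0 < d)%N ->
      let T := d%:R * \sum_(1 <= k < p ^ a)
                         'C(2 * k, k + d)%:R / (k%:R * 2 ^+ k) in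
      [/\ ((p ^ a)%N <> d %[mod 2])%Z -> eq_mod_p p (T - (-1) ^+ d) 0,
          ((p ^ a)%N = d %[mod 4])%Z -> eq_mod_p p (T - (-1) ^+ d) 1
        & ((p ^ a)%N = d%:Z + 2 %[mod 4])%Z -> eq_mod_p p (T - (-1) ^+ d) (-1)]].
Proof.
have n_odd : odd (p ^ a) by rewrite oddX p_odd orbT.
have p_gt2 : (2 < p)%N by rewrite odd_prime_gt2.
have charFp := pchar_Fp p_prime.
have n_char : [pchar 'F_p].-nat (p ^ a)%N by rewrite pnatX pnatE ?charFp.
have two_n : (2 : 'F_p) ^+ (p ^ a) = 2.
  by rewrite (exprDn_pchar 1 1 n_char) expr1n.
have two_neq0 : (2 : 'F_p) != 0.
  by rewrite -(dvdn_pcharf charFp) gtnNdvd.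
have N1_n (K : fieldType) : ((-1)%:~R : K) ^+ (p ^ a) = (-1)%:~R.
  by rewrite rmorphN1 -signr_odd n_odd expr1.
have N1_neq0 (K : fieldType) : ((-1)%:~R : K) != 0.
  by rewrite rmorphN1 oppr_eq0 oner_eq0.
have sgn (R : nzRingType) : (-1) ^+ (p ^ a - d) = - (-1) ^+ d :> R.
  rewrite -signr_odd oddB // n_odd -[in RHS](signr_odd _ d).
  by case: odd; rewrite /= ?opprK.
split.
- have [K [charKp eqU _]] := golden_mod_p p_prime p_odd a_gt0 d_le.
  have := central_binomial_sum_mod charKp (N1_neq0 K) (N1_n K) d_le eqU.
  congr eq_mod_p.
    by apply: eq_bigr => k _; rewrite rmorphN1 mulrC invr_sign.
  by rewrite signz_sub_bool !rmorphM !rmorphXn rmorphN1.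
- move=> d_gt0; have d_bounds : (0 < d <= p ^ a)%N by rewrite d_gt0.
  have [K [charKp _ eqV]] := golden_mod_p p_prime p_odd a_gt0 d_le.
  (* With z = 0, the boundary value V_(n-d)(-2) = -2(-1)^d produces the term -2(-1)^d of the
     statement. *)
  have Tmod (N : int) : lucasV (-1 - 2 : K) (p ^ a - d) = (- N)%:~R ->
      eq_mod_p p (d%:R * (\sum_(1 <= k < p ^ a)
        'C(2 * k, k + d)%:R / (k%:R * (-1)%:~R ^+ k)) - 0%:~R)
        (N - 2 * (-1) ^+ d)%:~R.
    move=> eqN; apply: (central_binomial_difference_sum_mod charKp (N1_neq0 K)
      (N1_n K) d_bounds a_gt0).
    rewrite addr0 [lucasV _ _]eqN lucasV_N2 sgn rmorphN rmorphB rmorphM.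
    by rewrite rmorphXn rmorphN1 /=; ring.
  have := Tmod _ eqV; congr eq_mod_p.
    rewrite subr0; congr (_ * _); apply: eq_bigr => k _.
    by rewrite rmorphN1 invfM invr_sign; ring.
  by rewrite signz_sub_bool rmorphB !rmorphM !rmorphXn rmorphN1.
- move=> S.
  (* At x = 2 the argument x - 2 is 0, so only n - d modulo 4 matters. *)
  have Smod N : lucasU (0 : 'F_p) (p ^ a - d) = N%:~R -> eq_mod_p p S N%:~R.
    rewrite -[0](subrr 2); exact: (@central_binomial_sum_mod _ p a d 2).
  split=> e.
  + have [q def_q] : exists q, (p ^ a - d = q.*2)%N.
      by exists ((p ^ a - d)./2); lia.
    by apply: (Smod 0); rewrite def_q lucasU0_double.
  + have [q def_q] : exists q, (p ^ a - d = 4 * q + 1)%N.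
      by exists ((p ^ a - d) %/ 4)%N; lia.
    apply: (Smod 1); rewrite def_q (_ : _ + _ = q.*2.*2.+1)%N; last lia.
    by rewrite lucasU0_doubleS -mul2n exprM sqrrN !expr1n.
  + have [q def_q] : exists q, (p ^ a - d = 4 * q + 3)%N.
      by exists ((p ^ a - d) %/ 4)%N; lia.
    apply: (Smod (-1)); rewrite def_q (_ : _ + _ = q.*2.+1.*2.+1)%N; last lia.
    by rewrite lucasU0_doubleS exprS -mul2n exprM sqrrN !expr1n mulr1 rmorphN1.
move=> d_gt0 T; have d_bounds : (0 < d <= p ^ a)%N by rewrite d_gt0.
(* With z = (-1)^d, the boundary value -2(-1)^d cancels against x z = 2(-1)^d. *)
have Tmod N : lucasV (0 : 'F_p) (p ^ a - d) = 2 * N%:~R ->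
    eq_mod_p p (T - (-1) ^+ d) N%:~R.
  rewrite -[0](subrr 2) => eqV.
  have -> : (-1) ^+ d = ((-1) ^+ d)%:~R :> rat by rewrite rmorphXn rmorphN1.
  apply: (@central_binomial_difference_sum_mod _ p a d 2 _ _
    charFp two_neq0 two_n d_bounds a_gt0).
  rewrite [lucasV (_ - 2) _]eqV lucasV_N2 sgn [(N + _)%:~R]rmorphD.
  by rewrite rmorphXn rmorphN1 /=; ring.
(* At y = 0, V_m = 2 U_(m+1), so the cases are those of [Smod] shifted by one. *)
rewrite /lucasV in Tmod.
split=> e.
+ have [q def_q] : exists q, (p ^ a - d = q.*2.+1)%N.
    by exists ((p ^ a - d)./2); lia.
  by apply: (Tmod 0); rewrite def_q -doubleS lucasU0_double !mul0r !mulr0 subr0.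
+ have [q def_q] : exists q, (p ^ a - d = 4 * q + 0)%N.
      by exists ((p ^ a - d) %/ 4)%N; lia.
  apply: (Tmod 1); rewrite def_q (_ : _ + _ = q.*2.*2)%N; last lia.
  by rewrite lucasU0_doubleS -mul2n exprM sqrrN !expr1n mul0r subr0.
+ have [q def_q] : exists q, (p ^ a - d = 4 * q + 2)%N.
      by exists ((p ^ a - d) %/ 4)%N; lia.
  apply: (Tmod (-1)); rewrite def_q (_ : _ + _ = q.*2.+1.*2)%N; last lia.
  rewrite lucasU0_doubleS exprS -mul2n exprM sqrrN !expr1n mul0r subr0.
  by rewrite rmorphN1 mulr1.
Qed.
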